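(* Let $0<|q|<1$, let $a>0$ be real and let $u\in\mathbb{C}\setminus\{0\}$. Then \[ \sum_{i,j\geq 0} \frac{u^{i-j}q^{\binom{i}{2}+\binom{j+1}{2}+a\binom{j-i}{2}}}{(q;q)_i(q;q)_j}=\frac{(-uq^a,-q/u,q^{a+1};q^{a+1})_\infty}{(q;q)_\infty}. \]
   Context: Real powers of $q$ are defined by $q^{x}=e^{x\log q}$ for a fixed choice of $\log q$. For $b\in\mathbb{C}$ and $|p|<1$: $(b;p)_0=1$, $(b;p)_n=\prod_{k=0}^{n-1}(1-bp^k)$, $(b;p)_\infty=\prod_{k\ge0}(1-bp^k)$, and $(b_1,\dots,b_m;p)_\infty=\prod_{r=1}^m(b_r;p)_\infty$. $\binom{n}{2}=n(n-1)/2$ for all integers $n$. *)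

(* Defs.v *)
From Stdlib Require Export Reals ZArith List.
From Coquelicot Require Export Coquelicot.
Open Scope R_scope.
Open Scope C_scope.

Definition Cexp (z : C) : C :=
  (exp (Re z) * cos (Im z), exp (Re z) * sin (Im z))%R.

(* [qpower logq x] is q^x, where [logq] is the chosen logarithm of q. *)
Definition qpower (logq : C) (x : R) : C := Cexp (RtoC x * logq).

Definition Cpowz (z : C) (n : Z) : C :=
  match n with
  | Z0 => 1
  | Zpos k => z ^ Pos.to_nat k
  | Zneg k => / z ^ Pos.to_nat k
  end.

Definition binom2 (n : Z) : R := (IZR n * (IZR n - 1) / 2)%R.

Fixpoint qpoch (b p : C) (n : nat) : C :=
  match n with
  | O => 1
  | S k => qpoch b p k * (1 - b * p ^ k)
  end.

(* The limit of [qpoch b p n] as n tends to infinity, taken on the real and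
   imaginary parts; it is meaningful for |p| < 1, where the product
   converges. *)
Definition qpoch_inf (b p : C) : C :=
  (real (Lim_seq (fun n => Re (qpoch b p n))),
   real (Lim_seq (fun n => Im (qpoch b p n)))).

Definition qpochs_inf (bs : list C) (p : C) : C :=
  fold_right Cmult 1 (map (fun b => qpoch_inf b p) bs).

(* Unconditional summation: the sums over finite subsets of I converge to l
   along inclusion.  For complex families this is absolute summability
   together with the value of the sum. *)
Definition is_sum {I : Type} (f : I -> C) (l : C) : Prop :=
  forall eps : posreal, exists s0 : list I,
    forall s : list I, NoDup s -> incl s0 s ->
      (Cmod (fold_right Cplus 0 (map f s) - l) < eps)%R.

(* Main.v *)
Require Import Defs.
From Stdlib Require Import Reals ZArith List FinFun Lra Lia.
From Stdlib Require Import Classical ClassicalEpsilon.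
From Coquelicot Require Import Coquelicot.
Import ListNotations.
Open Scope C_scope.

(* Let [t k = u^k q^(a C(-k,2))].  A finite form of the q-Vandermonde identity
   rewrites [sum_(i,j) t (i-j) q^(C(i,2)+C(j+1,2)) [N;i] [N;j]] as
   [sum_k t k q^(C(k,2)) [2N;N+k]], where [[N;i]] is a Gaussian binomial in q.
   Letting N tend to infinity by Tannery's theorem, the left side becomes the
   double sum of the theorem and the right side becomes
   [1/(q;q)_oo * sum_k t k q^(C(k,2))].  Since
   [t k q^(C(k,2)) = z^k Q^(C(k,2))] with [Q = q^(a+1)] and [z = u q^a], the
   Jacobi triple product in base Q, itself the limit of its finite form,
   evaluates the bilateral sum. *)

(** * Unconditional sums and dominated convergence *)

(** The factor q^(a C(-k,2)) has an exponent quadratic in k = i - j, so the double sum does not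
    factor into two single series and cannot be evaluated by two applications of the q-binomial
    theorem. The remedy is to compare coefficients: both sides of the finite identity are linear in
    [t], and it is proved for every function [t] on the integers, without growth conditions, because
    only finitely many terms are nonzero. Decay matters only in the limit. Since a > 0 and C(k,2) >=
    0 at every integer, q^(a C(-k,2)) has modulus at most 1; since C(j+1,2) = C(-j,2), the remaining
    weight splits into u^k q^(C(k,2)) at k = i and at k = -j; and the Gaussian binomials are bounded
    uniformly in all arguments. Hence a single Gaussian estimate supplies every majorant, as a
    constant times powers of 1/2. Bases are carried by their logarithms, so that the same lemmas
    serve q and q^(a+1), and indices range over all integers, so that shifts are bijections without
    boundary terms. *)

Definition Csum {I : Type} (f : I -> C) (s : list I) : C :=
  fold_right Cplus 0 (map f s).

Definition Rsum {I : Type} (f : I -> R) (s : list I) : R :=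
  fold_right Rplus 0%R (map f s).

Lemma Csum_app {I} (f : I -> C) s t : Csum f (s ++ t) = Csum f s + Csum f t.
Proof.
  unfold Csum; induction s as [|x s IH]; simpl; [ring|].
  rewrite IH; ring.
Qed.

Lemma Rsum_app {I} (f : I -> R) s t : Rsum f (s ++ t) = (Rsum f s + Rsum f t)%R.
Proof.
  unfold Rsum; induction s as [|x s IH]; simpl; [ring|].
  rewrite IH; ring.
Qed.

Lemma Csum_plus {I} (f g : I -> C) s :
  Csum (fun x => f x + g x) s = Csum f s + Csum g s.
Proof.
  unfold Csum; induction s as [|x s IH]; simpl; [ring|].
  rewrite IH; ring.
Qed.

Lemma Csum_scal {I} (c : C) (f : I -> C) s :
  Csum (fun x => c * f x) s = c * Csum f s.
Proof.
  unfold Csum; induction s as [|x s IH]; simpl; [ring|].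
  rewrite IH; ring.
Qed.

Lemma Csum_zero {I} (f : I -> C) s :
  (forall x, In x s -> f x = 0) -> Csum f s = 0.
Proof.
  unfold Csum; induction s as [|x s IH]; simpl; intros H; [reflexivity|].
  rewrite (H x) by auto. rewrite IH by auto. ring.
Qed.

Lemma Csum_single {I} (f : I -> C) (i0 : I) s :
  (forall i, i <> i0 -> f i = 0) -> NoDup s -> In i0 s -> Csum f s = f i0.
Proof.
  intros Hf Hs Hin. destruct (in_split _ _ Hin) as [l1 [l2 ->]].
  apply NoDup_remove_2 in Hs.
  rewrite Csum_app. change (i0 :: l2) with ([i0] ++ l2). rewrite Csum_app.
  rewrite (Csum_zero f l1), (Csum_zero f l2).
  - unfold Csum; simpl; ring.
  - intros x Hx; apply Hf; intros ->; apply Hs, in_or_app; auto.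
  - intros x Hx; apply Hf; intros ->; apply Hs, in_or_app; auto.
Qed.

Lemma Cmod_Csum_le {I} (f : I -> C) (M : I -> R) s :
  (forall x, Cmod (f x) <= M x)%R -> (Cmod (Csum f s) <= Rsum M s)%R.
Proof.
  intros H; unfold Csum, Rsum; induction s as [|x s IH]; simpl.
  - rewrite Cmod_0; lra.
  - eapply Rle_trans; [apply Cmod_triangle|]. specialize (H x); lra.
Qed.

(** Serves to enlarge a partial sum past a threshold set [s1]: the added block [r] is disjoint from
    [s], so its contribution can be estimated, or seen to vanish, separately. *)
Lemma NoDup_extend {I} (s s1 : list I) : NoDup s ->
  exists r, NoDup (s ++ r) /\ incl s1 (s ++ r) /\
    (forall x, In x r -> In x s1 /\ ~ In x s).
Proof.
  intros Hs; induction s1 as [|x s1 [r [Hr [Hi Hn]]]].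
  - exists []. rewrite app_nil_r. repeat split; auto; try easy.
  - destruct (classic (In x (s ++ r))) as [Hx|Hx].
    + exists r. split; [auto|split].
      * intros y [<-|Hy]; auto.
      * intros y Hy; destruct (Hn y Hy); simpl; auto.
    + exists (x :: r). split; [|split].
      * apply NoDup_Add with (a := x) (l := s ++ r).
        -- apply Add_app.
        -- split; auto.
      * intros y [<-|Hy].
        -- apply in_or_app; simpl; auto.
        -- apply Hi, in_app_or in Hy. apply in_or_app; simpl; tauto.
      * intros y [<-|Hy].
        -- simpl; split; auto. intros H; apply Hx, in_or_app; auto.
        -- destruct (Hn y Hy); simpl; auto.
Qed.

Lemma is_sum_ext {I} (f g : I -> C) l l' :
  (forall x, f x = g x) -> l = l' -> is_sum f l -> is_sum g l'.
Proof.
  intros H <- Hf eps. destruct (Hf eps) as [s0 Hs0]. exists s0. intros s H1 H2.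
  rewrite <- (map_ext _ _ H). auto.
Qed.

Lemma is_sum_plus {I} (f g : I -> C) l m :
  is_sum f l -> is_sum g m -> is_sum (fun x => f x + g x) (l + m).
Proof.
  intros Hf Hg eps.
  destruct (Hf (pos_div_2 eps)) as [s1 H1].
  destruct (Hg (pos_div_2 eps)) as [s2 H2].
  exists (s1 ++ s2). intros s Hs Hi.
  specialize (H1 s Hs (fun x Hx => Hi x (in_or_app _ _ _ (or_introl Hx)))).
  specialize (H2 s Hs (fun x Hx => Hi x (in_or_app _ _ _ (or_intror Hx)))).
  fold (Csum (fun x => f x + g x) s). rewrite Csum_plus.
  fold (Csum f s) in H1. fold (Csum g s) in H2. simpl in H1, H2.
  replace (_ - _) with ((Csum f s - l) + (Csum g s - m)) by ring.
  eapply Rle_lt_trans; [apply Cmod_triangle|]. lra.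
Qed.

Lemma is_sum_scal {I} (c : C) (f : I -> C) l :
  is_sum f l -> is_sum (fun x => c * f x) (c * l).
Proof.
  intros Hf eps.
  assert (Hc : (0 < Cmod c + 1)%R) by (pose proof (Cmod_ge_0 c); lra).
  assert (He : (0 < eps / (Cmod c + 1))%R)
    by (apply Rdiv_lt_0_compat; [apply cond_pos|auto]).
  destruct (Hf (mkposreal _ He)) as [s0 H]. exists s0. intros s Hs Hi.
  specialize (H s Hs Hi). simpl in H. fold (Csum f s) in H.
  fold (Csum (fun x => c * f x) s). rewrite Csum_scal.
  replace (_ - _) with (c * (Csum f s - l)) by ring.
  rewrite Cmod_mult.
  apply (Rmult_lt_compat_r _ _ _ Hc) in H.
  unfold Rdiv in H. rewrite Rmult_assoc, Rinv_l, Rmult_1_r in H by lra.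
  pose proof (Cmod_ge_0 (Csum f s - l)). nra.
Qed.

Lemma is_sum_single {I} (f : I -> C) (i0 : I) :
  (forall i, i <> i0 -> f i = 0) -> is_sum f (f i0).
Proof.
  intros Hf eps. exists [i0]. intros s Hs Hi.
  fold (Csum f s). rewrite (Csum_single f i0); auto.
  - replace (f i0 - f i0) with (RtoC 0) by ring. rewrite Cmod_0. apply cond_pos.
  - apply Hi; simpl; auto.
Qed.

Lemma is_sum_reindex {I J} (e : J -> I) (f : I -> C) l :
  (forall x y, e x = e y -> x = y) ->
  (forall i, f i <> 0 -> exists j, e j = i) ->
  is_sum f l -> is_sum (fun j => f (e j)) l.
Proof.
  intros He Hf Hs eps. destruct (Hs eps) as [s0 H0].
  (* Injectivity of [e] makes the preimage of the finite set [s0] finite. *)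
  assert (Ht : exists t0, forall j, In (e j) s0 -> In j t0).
  { clear H0. induction s0 as [|i s0 [t0 IH]].
    - exists []; simpl; tauto.
    - destruct (classic (exists j, e j = i)) as [[j Hj]|Hn].
      + exists (j :: t0). intros k [Hk|Hk]; simpl; auto.
        left; apply He; congruence.
      + exists t0. intros k [Hk|Hk]; auto. exfalso; apply Hn; eauto. }
  destruct Ht as [t0 Ht]. exists t0. intros s Hnd Hi.
  assert (Hnd' : NoDup (map e s)).
  { apply Injective_map_NoDup; auto. }
  destruct (NoDup_extend (map e s) s0 Hnd') as [r [Hr [Hinc Hn]]].
  specialize (H0 _ Hr Hinc).
  fold (Csum f (map e s ++ r)) in H0. rewrite Csum_app in H0.
  rewrite (Csum_zero f r) in H0.
  - unfold Csum in H0. rewrite map_map, Cplus_0_r in H0. exact H0.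
  (* A nonzero added term would have an index [e j] in [s0], hence [j] in [t0] and so in [s], but
     the added indices avoid [map e s]. *)
  - intros x Hx. destruct (Hn x Hx) as [Hx0 Hx1].
    apply NNPP; intros Hne. destruct (Hf x Hne) as [j <-].
    apply Hx1, in_map, Hi, Ht, Hx0.
Qed.

(** * Limits of complex sequences *)

Definition Clim (s : nat -> C) (l : C) : Prop :=
  is_lim_seq (fun n => Cmod (s n - l)) 0.

Lemma Clim_eps (s : nat -> C) l :
  Clim s l <-> forall eps : posreal, exists N, forall n, (N <= n)%nat ->
    (Cmod (s n - l) < eps)%R.
Proof.
  unfold Clim. rewrite <- is_lim_seq_spec. simpl. split; intros H eps;
    destruct (H eps) as [N HN]; exists N; intros n Hn; specialize (HN n Hn);
    rewrite Rminus_0_r, Rabs_pos_eq in * by apply Cmod_ge_0; auto.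
Qed.

Lemma Clim_le (s : nat -> C) l (v : nat -> R) :
  (forall n, Cmod (s n - l) <= v n)%R -> is_lim_seq v 0 -> Clim s l.
Proof.
  intros H Hv. apply is_lim_seq_le_le with (fun _ => 0%R) v; auto.
  - intros n; split; auto. apply Cmod_ge_0.
  - apply is_lim_seq_const.
Qed.

Lemma Clim_const (c : C) : Clim (fun _ => c) c.
Proof.
  apply Clim_le with (fun _ => 0%R); [|apply is_lim_seq_const].
  intros _. replace (c - c) with (RtoC 0) by ring. rewrite Cmod_0; lra.
Qed.

Lemma Clim_ext (s t : nat -> C) l : (forall n, s n = t n) -> Clim s l -> Clim t l.
Proof.
  intros H. apply is_lim_seq_ext. intros n; rewrite H; reflexivity.
Qed.

Lemma Clim_ext_loc (s t : nat -> C) l N :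
  (forall n, (N <= n)%nat -> s n = t n) -> Clim s l -> Clim t l.
Proof.
  intros H. apply is_lim_seq_ext_loc. exists N. intros n Hn; rewrite H; auto.
Qed.

Lemma Clim_subseq (s : nat -> C) l (phi : nat -> nat) :
  (forall K, exists N, forall n, (N <= n)%nat -> (K <= phi n)%nat) ->
  Clim s l -> Clim (fun n => s (phi n)) l.
Proof.
  rewrite !Clim_eps. intros Hphi H eps. destruct (H eps) as [K HK].
  destruct (Hphi K) as [N HN]. exists N; auto.
Qed.

Lemma Clim_plus (s t : nat -> C) l m :
  Clim s l -> Clim t m -> Clim (fun n => s n + t n) (l + m).
Proof.
  intros Hs Ht.
  apply Clim_le with (fun n => Cmod (s n - l) + Cmod (t n - m))%R.
  - intros n. replace (_ - _) with ((s n - l) + (t n - m)) by ring.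
    apply Cmod_triangle.
  - replace (Finite 0) with (Finite (0 + 0)) by (f_equal; ring).
    apply is_lim_seq_plus'; auto.
Qed.

Lemma Clim_mult (s t : nat -> C) l m :
  Clim s l -> Clim t m -> Clim (fun n => s n * t n) (l * m).
Proof.
  intros Hs Ht.
  apply Clim_le with (fun n => Cmod (s n - l) * Cmod (t n - m) +
     (Cmod (s n - l) * Cmod m + Cmod l * Cmod (t n - m)))%R.
  - intros n. replace (_ - _) with
      ((s n - l) * (t n - m) + ((s n - l) * m + l * (t n - m))) by ring.
    eapply Rle_trans; [apply Cmod_triangle|]. rewrite Cmod_mult.
    apply Rplus_le_compat_l.
    eapply Rle_trans; [apply Cmod_triangle|]. rewrite !Cmod_mult. lra.
  - replace (Finite 0) with (Finite (0 * 0 + (0 * Cmod m + Cmod l * 0)))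
      by (f_equal; ring).
    apply is_lim_seq_plus'; [apply is_lim_seq_mult'; auto|].
    apply is_lim_seq_plus'; apply is_lim_seq_mult'; auto;
      apply is_lim_seq_const.
Qed.

Lemma Cmod_Clim_le (s : nat -> C) l B :
  (forall n, Cmod (s n) <= B)%R -> Clim s l -> (Cmod l <= B)%R.
Proof.
  intros H Hs. apply le_epsilon. intros eps He.
  destruct (proj1 (Clim_eps s l) Hs (mkposreal eps He)) as [N HN].
  specialize (HN N (le_n N)). simpl in HN. specialize (H N).
  replace l with (s N + - (s N - l)) by ring.
  eapply Rle_trans; [apply Cmod_triangle|]. rewrite Cmod_opp. lra.
Qed.

Lemma Clim_inv (s : nat -> C) l (K : R) :
  (forall n, s n <> 0) -> (forall n, Cmod (/ s n) <= K)%R ->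
  Clim s l -> l <> 0 -> Clim (fun n => / s n) (/ l).
Proof.
  intros H0 HK Hs Hl.
  apply Clim_le with (fun n => K * Cmod (/ l) * Cmod (s n - l))%R.
  - intros n. replace (_ - _) with (- (/ s n * / l * (s n - l))).
    + rewrite Cmod_opp, !Cmod_mult.
      apply Rmult_le_compat_r; [apply Cmod_ge_0|].
      apply Rmult_le_compat_r; [apply Cmod_ge_0|auto].
    + field; auto.
  - replace (Finite 0) with (Finite (K * Cmod (/ l) * 0)) by (f_equal; ring).
    apply is_lim_seq_mult'; auto. apply is_lim_seq_const.
Qed.

Lemma Clim_Csum {I} (F : nat -> I -> C) (f : I -> C) s :
  (forall x, Clim (fun n => F n x) (f x)) ->
  Clim (fun n => Csum (F n) s) (Csum f s).
Proof.
  intros H. unfold Csum. induction s as [|x s IH]; simpl.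
  - apply Clim_const.
  - apply Clim_plus; auto.
Qed.

(** * Summable majorants and Tannery's theorem *)

Definition summable {I : Type} (M : I -> R) : Prop :=
  exists B, forall s, NoDup s -> (Rsum M s <= B)%R.

Lemma summable_tail {I} (M : I -> R) (eps : posreal) : summable M ->
  exists s0, NoDup s0 /\ forall r, NoDup r -> (forall x, In x r -> ~ In x s0) ->
    (Rsum M r < eps)%R.
Proof.
  intros [B HB].
  destruct (completeness (fun v => exists s, NoDup s /\ v = Rsum M s)) as [m [Hu Hl]].
  - exists B. intros v [s [Hs ->]]; auto.
  - exists 0%R, []. split; [constructor|reflexivity].
  - apply NNPP. intros Hn.
    (* A finite sum exceeding [m - eps], with [m] the supremum, leaves less than [eps] for any
       disjoint block; if there were none, [m - eps] would already be an upper bound. *)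
    assert (m <= m - eps)%R; [|destruct eps; simpl in *; lra].
    apply Hl. intros v [s [Hs ->]].
    apply Rnot_lt_le. intros Hlt. apply Hn. exists s. split; auto.
    intros r Hr Hd.
    assert (Rsum M (s ++ r) <= m)%R.
    { apply Hu. exists (s ++ r); split; auto.
      apply NoDup_app; auto. intros x Hx Hx'; exact (Hd x Hx' Hx). }
    rewrite Rsum_app in H. lra.
Qed.

(** The order of quantifiers is the point: [s0] depends on the majorant and on [eps] only, so one
    finite set truncates every dominated family at once. This is the uniformity behind both limit
    theorems below. *)
Lemma summable_is_sum_close {I} (M : I -> R) (eps : posreal) : summable M ->
  exists s0, NoDup s0 /\ forall (f : I -> C) l,
    (forall x, Cmod (f x) <= M x)%R -> is_sum f l ->
    forall s, NoDup s -> incl s0 s -> (Cmod (Csum f s - l) < eps)%R.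
Proof.
  intros HM. destruct (summable_tail M (pos_div_2 eps) HM) as [s0 [Hnd Ht]].
  exists s0. split; auto. intros f l Hf Hl s Hs Hi.
  destruct (Hl (pos_div_2 eps)) as [s1 H1].
  destruct (NoDup_extend s s1 Hs) as [r [Hr [Hinc Hn]]].
  specialize (H1 _ Hr Hinc). fold (Csum f (s ++ r)) in H1.
  rewrite Csum_app in H1.
  assert (Hrs : (Rsum M r < pos_div_2 eps)%R).
  { apply Ht. apply NoDup_app_remove_l in Hr; auto.
    intros x Hx Hx0. apply (proj2 (Hn x Hx)); auto. }
  pose proof (Cmod_Csum_le f M r Hf). simpl in *.
  replace (_ - _) with ((Csum f s + Csum f r - l) + - Csum f r) by ring.
  eapply Rle_lt_trans; [apply Cmod_triangle|]. rewrite Cmod_opp. lra.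
Qed.

Lemma Cmod_dist3 (a b c d : C) (e1 e2 e3 : R) :
  (Cmod (a - b) < e1)%R -> (Cmod (a - c) < e2)%R -> (Cmod (c - d) < e3)%R ->
  (Cmod (b - d) < e1 + e2 + e3)%R.
Proof.
  intros H1 H2 H3. replace (b - d) with (- (a - b) + ((a - c) + (c - d))) by ring.
  eapply Rle_lt_trans; [apply Cmod_triangle|]. rewrite Cmod_opp.
  pose proof (Cmod_triangle (a - c) (c - d)). lra.
Qed.

Theorem tannery {I} (M : I -> R) (F : nat -> I -> C) (f : I -> C) (L : nat -> C) l :
  summable M -> (forall n x, Cmod (F n x) <= M x)%R ->
  (forall x, Clim (fun n => F n x) (f x)) ->
  (forall n, is_sum (F n) (L n)) -> Clim L l -> is_sum f l.
Proof.
  intros HM HF Hf HL Hl eps.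
  destruct (summable_is_sum_close M (pos_div_2 eps) HM) as [s0 [_ H0]].
  exists s0. intros s Hs Hi. fold (Csum f s).
  destruct (proj1 (Clim_eps _ _) (Clim_Csum F f s Hf)
    (pos_div_2 (pos_div_2 eps))) as [N1 H1].
  destruct (proj1 (Clim_eps _ _) Hl (pos_div_2 (pos_div_2 eps))) as [N2 H2].
  specialize (H1 (N1 + N2)%nat ltac:(lia)). specialize (H2 (N1 + N2)%nat ltac:(lia)).
  pose proof (H0 _ _ (HF (N1 + N2)%nat) (HL _) s Hs Hi) as H3.
  pose proof (Cmod_dist3 _ _ _ _ _ _ _ H1 H3 H2). simpl in *. lra.
Qed.

(** Dominated convergence in the other direction: the sum of the limit family is known and the limit
    of the sums is wanted. *)
Theorem tannery_lim {I} (M : I -> R) (F : nat -> I -> C) (f : I -> C) (L : nat -> C) l :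
  summable M -> (forall n x, Cmod (F n x) <= M x)%R ->
  (forall x, Clim (fun n => F n x) (f x)) ->
  (forall n, is_sum (F n) (L n)) -> is_sum f l -> Clim L l.
Proof.
  intros HM HF Hf HL Hl. apply Clim_eps. intros eps.
  destruct (summable_is_sum_close M (pos_div_2 (pos_div_2 eps)) HM) as [s0 [Hs H0]].
  destruct (proj1 (Clim_eps _ _) (Clim_Csum F f s0 Hf) (pos_div_2 eps)) as [N1 H1].
  exists N1. intros n Hn. specialize (H1 n Hn).
  pose proof (H0 _ _ (HF n) (HL n) s0 Hs (incl_refl _)) as H2.
  (* The pointwise limit inherits the majorant, so the same [s0] truncates it as well. *)
  assert (Hfm : forall x, (Cmod (f x) <= M x)%R).
  { intros x. eapply Cmod_Clim_le; [|apply Hf]. intros k; apply HF. }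
  pose proof (H0 _ _ Hfm Hl s0 Hs (incl_refl _)) as H3.
  pose proof (Cmod_dist3 _ _ _ _ _ _ _ H2 H1 H3). simpl in *. lra.
Qed.

Lemma Rsum_incl_le {I} (M : I -> R) s t :
  (forall x, 0 <= M x)%R -> NoDup s -> incl s t -> (Rsum M s <= Rsum M t)%R.
Proof.
  intros HM. revert t. induction s as [|x s IH]; intros t Hs Hi.
  - unfold Rsum at 1; simpl. clear Hi. induction t; unfold Rsum in *; simpl; [lra|].
    specialize (HM a); lra.
  - destruct (in_split x t) as [t1 [t2 ->]]; [apply Hi; simpl; auto|].
    apply NoDup_cons_iff in Hs. destruct Hs as [Hx Hs].
    specialize (IH (t1 ++ t2) Hs).
    rewrite Rsum_app in *. unfold Rsum in *. simpl.
    assert (incl s (t1 ++ t2)); [|specialize (IH H); lra].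
    intros y Hy. specialize (Hi y (or_intror Hy)).
    apply in_app_or in Hi. apply in_or_app. destruct Hi as [|[->|]]; auto.
    contradiction.
Qed.

(** Every finite set of pairs lies in a square, over which the sum factors into two geometric sums,
    each at most 2. *)
Lemma summable_geom2 (K : R) : (0 <= K)%R ->
  summable (fun ij : nat * nat => K * (/ 2) ^ (fst ij) * (/ 2) ^ (snd ij))%R.
Proof.
  intros HK.
  assert (Hp : forall n, (0 <= (/ 2) ^ n)%R) by (intros; apply pow_le; lra).
  assert (Hg : forall n, (0 <= Rsum (fun i => (/ 2) ^ i)%R (seq 0 n) <= 2 - (/2) ^ n * 2)%R).
  { induction n as [|n IH]; [unfold Rsum; simpl; lra|].
    rewrite seq_S, Rsum_app. unfold Rsum at 2 4. simpl.
    specialize (Hp n). lra. }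
  assert (Hprod : forall n l, Rsum (fun ij : nat * nat => K * (/ 2) ^ (fst ij) * (/ 2) ^ (snd ij))%R
      (list_prod l (seq 0 n)) =
      (K * Rsum (fun i => (/ 2) ^ i) l * Rsum (fun i => (/ 2) ^ i) (seq 0 n))%R).
  { intros n l. induction l as [|i l IH]; [unfold Rsum; simpl; ring|].
    simpl. rewrite Rsum_app, IH. unfold Rsum at 4; simpl.
    fold (Rsum (fun i => (/2) ^ i)%R l).
    assert (Hm : forall t, Rsum (fun ij : nat * nat => K * (/ 2) ^ (fst ij) * (/ 2) ^ (snd ij))%R
      (map (fun y => (i, y)) t) = (K * (/ 2) ^ i * Rsum (fun i => (/ 2) ^ i) t)%R).
    { intros t; induction t as [|j t IHt]; unfold Rsum in *; simpl; [ring|].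
      rewrite IHt; ring. }
    rewrite Hm. ring. }
  exists (K * 2 * 2)%R. intros s Hs.
  assert (Hb : exists n, forall i j, In (i, j) s -> (i < n /\ j < n)%nat).
  { clear Hs. induction s as [|[i j] s [n IH]]; [exists 0%nat; simpl; tauto|].
    exists (n + i + j + 1)%nat. intros i' j' [H|H].
    - injection H as <- <-; lia.
    - apply IH in H; lia. }
  destruct Hb as [n Hn].
  eapply Rle_trans; [apply Rsum_incl_le with (t := list_prod (seq 0 n) (seq 0 n))|].
  - intros [i j]; simpl. pose proof (Hp i); pose proof (Hp j).
    repeat apply Rmult_le_pos; auto.
  - auto.
  - intros [i j] Hij. apply Hn in Hij. apply in_prod; apply in_seq; lia.
  - rewrite Hprod. specialize (Hg n). specialize (Hp n).
    rewrite !Rmult_assoc. apply Rmult_le_compat_l; auto.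
    apply Rmult_le_compat; lra.
Qed.

Lemma summable_le {I} (M N : I -> R) :
  (forall x, M x <= N x)%R -> summable N -> summable M.
Proof.
  intros H [B HB]. exists B. intros s Hs. eapply Rle_trans; [|apply HB, Hs].
  unfold Rsum. clear Hs. induction s as [|x s IH]; simpl; [lra|].
  specialize (H x); lra.
Qed.

Lemma summable_reindex {I J} (e : J -> I) (M : I -> R) :
  (forall x y, e x = e y -> x = y) -> summable M -> summable (fun j => M (e j)).
Proof.
  intros He [B HB]. exists B. intros s Hs.
  specialize (HB (map e s) (Injective_map_NoDup He Hs)).
  unfold Rsum in *. rewrite map_map in HB. exact HB.
Qed.

Lemma summable_geomZ (K : R) : (0 <= K)%R ->
  summable (fun k : Z => K * (/ 2) ^ (Z.abs_nat k))%R.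
Proof.
  intros HK.
  (* Positive and negative part embed the integers into pairs of naturals, and |k| is the sum of the
     two parts. *)
  apply summable_le with (fun k : Z =>
    (fun ij : nat * nat => K * (/ 2) ^ (fst ij) * (/ 2) ^ (snd ij))%R
      (Z.to_nat k, Z.to_nat (- k))).
  - intros k. simpl. rewrite Rmult_assoc, <- pow_add.
    replace (Z.to_nat k + Z.to_nat (- k))%nat with (Z.abs_nat k) by lia. lra.
  - apply (summable_reindex (fun k => (Z.to_nat k, Z.to_nat (- k)))
      (fun ij : nat * nat => K * (/ 2) ^ (fst ij) * (/ 2) ^ (snd ij))%R).
    + intros x y H. injection H. lia.
    + apply summable_geom2, HK.
Qed.

(** * Real powers of q and limits of q-shifted factorials *)

Lemma Cexp_plus (z w : C) : Cexp (z + w) = Cexp z * Cexp w.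
Proof.
  destruct z as [x y], w as [x' y']. unfold Cexp, Cmult, Cplus, Re, Im; simpl.
  rewrite exp_plus, cos_plus, sin_plus. f_equal; ring.
Qed.

Lemma Cmod_Cexp (z : C) : Cmod (Cexp z) = exp (Re z).
Proof.
  unfold Cmod, Cexp; simpl.
  replace (_ + _)%R with (exp (Re z) * exp (Re z))%R.
  - apply sqrt_square. left; apply exp_pos.
  - pose proof (sin2_cos2 (Im z)) as H. unfold Rsqr in H.
    transitivity (exp (Re z) * exp (Re z) *
      (sin (Im z) * sin (Im z) + cos (Im z) * cos (Im z)))%R; [rewrite H|]; ring.
Qed.

Lemma qpower_plus lq x y : qpower lq (x + y) = qpower lq x * qpower lq y.
Proof.
  unfold qpower. rewrite <- Cexp_plus. f_equal. rewrite RtoC_plus. ring.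
Qed.

Lemma qpower_0 lq : qpower lq 0 = 1.
Proof.
  unfold qpower. rewrite Cmult_0_l. unfold Cexp; simpl.
  rewrite exp_0, cos_0, sin_0. unfold RtoC. f_equal; ring.
Qed.

Lemma qpower_pow lq n : qpower lq (INR n) = Cexp lq ^ n.
Proof.
  induction n as [|n IH]; [apply qpower_0|].
  rewrite S_INR, qpower_plus, IH. simpl.
  unfold qpower at 1. rewrite Cmult_1_l. ring.
Qed.

Lemma Cmod_qpower lq x : Cmod (qpower lq x) = exp (x * Re lq).
Proof.
  unfold qpower. rewrite Cmod_Cexp. f_equal. unfold Re; simpl; ring.
Qed.

Lemma qpower_neq_0 lq x : qpower lq x <> 0.
Proof.
  apply Cmod_gt_0. rewrite Cmod_qpower. apply exp_pos.
Qed.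

(** Change of base: [c * lq] is the chosen logarithm of q^c. It is what lets a result stated for an
    arbitrary [lq] be used in base q^(a+1). *)
Lemma qpower_scal lq (c x : R) : qpower (RtoC c * lq) x = qpower lq (c * x).
Proof.
  unfold qpower. rewrite RtoC_mult. f_equal; ring.
Qed.

Lemma Cmod_qpower_le_1 lq x : (Re lq <= 0)%R -> (0 <= x)%R ->
  (Cmod (qpower lq x) <= 1)%R.
Proof.
  intros H Hx. rewrite Cmod_qpower, <- exp_0.
  destruct (Rle_lt_or_eq_dec (x * Re lq) 0) as [Hl|He]; [nra| |].
  - left; apply exp_increasing; auto.
  - rewrite He; lra.
Qed.

Lemma exp_le_compat x y : (x <= y)%R -> (exp x <= exp y)%R.
Proof.
  intros [H| ->]; [left; apply exp_increasing; auto|lra].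
Qed.

Lemma qpoch_le (b p : C) n : (Cmod p < 1)%R ->
  (Cmod (qpoch b p n) <= exp (Cmod b / (1 - Cmod p)))%R.
Proof.
  intros Hp. pose proof (Cmod_ge_0 p) as Hp0. pose proof (Cmod_ge_0 b) as Hb0.
  (* The induction needs the partial geometric sum in the exponent: it grows by exactly |b| |p|^n,
     which absorbs the new factor through 1 + x <= exp x. *)
  apply Rle_trans with (exp (Cmod b * (1 - Cmod p ^ n) / (1 - Cmod p))).
  - induction n as [|n IH].
    + simpl. rewrite Cmod_1. replace (_ / _)%R with 0%R by (field; lra).
      rewrite exp_0; lra.
    + replace (_ / _)%R with
        (Cmod b * (1 - Cmod p ^ n) / (1 - Cmod p) + Cmod b * Cmod p ^ n)%R
        by (simpl; field; lra).
      rewrite exp_plus. simpl qpoch. rewrite Cmod_mult.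
      apply Rmult_le_compat; try apply Cmod_ge_0; auto.
      eapply Rle_trans; [|apply exp_ineq1_le].
      unfold Cminus. eapply Rle_trans; [apply Cmod_triangle|].
      rewrite Cmod_opp, Cmod_1, Cmod_mult, Cmod_pow. lra.
  - apply exp_le_compat. apply Rmult_le_compat_r.
    + left; apply Rinv_0_lt_compat; lra.
    + assert (0 <= Cmod p ^ n)%R by (apply pow_le; auto). nra.
Qed.

Lemma ex_finite_lim_seq_geom (v : nat -> R) (K r : R) : (0 <= r < 1)%R ->
  (forall n, Rabs (v (S n) - v n) <= K * r ^ n)%R -> ex_finite_lim_seq v.
Proof.
  intros Hr Hv.
  assert (Hs : ex_series (fun n => v (S n) - v n)%R).
  { apply (@ex_series_le R_AbsRing R_CompleteNormedModule _ (fun n => (K * r ^ n)%R)).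
    - exact Hv.
    - apply (ex_series_scal_l K (fun n => r ^ n)%R).
      apply ex_series_geom. rewrite Rabs_pos_eq; lra. }
  destruct Hs as [l Hl]. exists (l + v 0%nat)%R.
  apply is_lim_seq_incr_1.
  apply is_lim_seq_ext with
    (fun n => sum_n (fun k => v (S k) - v k)%R n + v 0%nat)%R.
  - induction n as [|n IH].
    + rewrite sum_O. ring.
    + rewrite sum_Sn. unfold plus; simpl. simpl in IH. lra.
  - apply is_lim_seq_plus'; [exact Hl|apply is_lim_seq_const].
Qed.

Lemma Rabs_Im_le (z : C) : (Rabs (Im z) <= Cmod z)%R.
Proof. eapply Rle_trans; [apply Rmax_r|apply Rmax_Cmod]. Qed.

Lemma Cmod_le_Re_Im (z : C) : (Cmod z <= Rabs (Re z) + Rabs (Im z))%R.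
Proof.
  replace z with (RtoC (Re z) + Ci * RtoC (Im z)) at 1.
  - eapply Rle_trans; [apply Cmod_triangle|].
    rewrite Cmod_mult, Cmod_Ci, !Cmod_R. lra.
  - destruct z; unfold Ci, RtoC, Cmult, Cplus; simpl. f_equal; ring.
Qed.

Lemma is_lim_seq_dist (v : nat -> R) (l : R) :
  is_lim_seq v l -> is_lim_seq (fun n => Rabs (v n - l)) 0.
Proof.
  intros H. apply (is_lim_seq_abs_0 (fun n => v n - l)%R).
  replace (Finite 0) with (Finite (l - l)) by (f_equal; ring).
  apply is_lim_seq_minus'; auto. apply is_lim_seq_const.
Qed.

(** [qpoch_inf] is built from the total function [Lim_seq]. Successive differences of the finite
    products are geometrically small, so both limits exist and [qpoch_inf] is the actual infinite
    product. *)
Lemma Clim_qpoch (b p : C) : (Cmod p < 1)%R ->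
  Clim (qpoch b p) (qpoch_inf b p).
Proof.
  intros Hp. set (K := (exp (Cmod b / (1 - Cmod p)) * Cmod b)%R).
  assert (Hd : forall n,
    (Cmod (qpoch b p (S n) - qpoch b p n) <= K * Cmod p ^ n)%R).
  { intros n. simpl. replace (_ - _) with (- (qpoch b p n * (b * p ^ n))) by ring.
    rewrite Cmod_opp, !Cmod_mult, Cmod_pow. unfold K.
    pose proof (qpoch_le b p n Hp). rewrite <- Rmult_assoc.
    apply Rmult_le_compat_r; [apply pow_le, Cmod_ge_0|].
    apply Rmult_le_compat_r; [apply Cmod_ge_0|auto]. }
  assert (Hr : (0 <= Cmod p < 1)%R) by (split; [apply Cmod_ge_0|auto]).
  assert (HR : ex_finite_lim_seq (fun n => Re (qpoch b p n))).
  { apply ex_finite_lim_seq_geom with K (Cmod p); auto.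
    intros n. eapply Rle_trans; [|apply Hd]. apply (re_le_Cmod (qpoch b p (S n) - qpoch b p n)). }
  assert (HI : ex_finite_lim_seq (fun n => Im (qpoch b p n))).
  { apply ex_finite_lim_seq_geom with K (Cmod p); auto.
    intros n. eapply Rle_trans; [|apply Hd]. apply (Rabs_Im_le (qpoch b p (S n) - qpoch b p n)). }
  apply Lim_seq_correct' in HR. apply Lim_seq_correct' in HI.
  apply Clim_le with (fun n => Rabs (Re (qpoch b p n) - Re (qpoch_inf b p)) +
    Rabs (Im (qpoch b p n) - Im (qpoch_inf b p)))%R.
  - intros n. apply (Cmod_le_Re_Im (qpoch b p n - qpoch_inf b p)).
  - replace (Finite 0) with (Finite (0 + 0)) by (f_equal; ring).
    apply is_lim_seq_plus'; apply is_lim_seq_dist; auto.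
Qed.

(** Each inverse factor with |x| = r^k <= r obeys 1/(1 - |x|) = 1 + |x|/(1 - |x|) <= exp(|x|/(1 -
    r)), and the exponents add up to a geometric sum. The bound is free of [n], so it also keeps the
    infinite product away from 0. *)
Lemma Cmod_qpoch_inv_le (p : C) n : (Cmod p < 1)%R ->
  qpoch p p n <> 0 /\
  (Cmod (/ qpoch p p n) <= exp (/ (1 - Cmod p) * / (1 - Cmod p)))%R.
Proof.
  intros Hp. set (r := Cmod p) in *.
  assert (Hr0 : (0 <= r)%R) by apply Cmod_ge_0.
  assert (Hpow : forall k, (0 <= r ^ k)%R) by (intros; apply pow_le; auto).
  assert (Hi : (0 < / (1 - r))%R) by (apply Rinv_0_lt_compat; lra).
  enough (H : qpoch p p n <> 0 /\
    (Cmod (/ qpoch p p n) <= exp (/ (1 - r) * (r * (1 - r ^ n) / (1 - r))))%R).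
  { destruct H as [H0 H]. split; auto. eapply Rle_trans; [exact H|].
    apply exp_le_compat. apply Rmult_le_compat_l; [lra|]. unfold Rdiv.
    rewrite <- (Rmult_1_l (/ (1 - r))) at 2.
    apply Rmult_le_compat_r; [lra|]. specialize (Hpow n). nra. }
  induction n as [|n [IH0 IH]].
  - simpl. split; [apply C1_nz|].
    replace (/ 1) with (RtoC 1) by field.
    rewrite Cmod_1. replace (_ * _)%R with 0%R by (field; lra).
    rewrite exp_0; lra.
  - simpl qpoch. set (x := p * p ^ n).
    assert (Hx : Cmod x = (r * r ^ n)%R) by (unfold x; rewrite Cmod_mult, Cmod_pow; auto).
    assert (Hxr : (Cmod x <= r)%R).
    { rewrite Hx. assert (r ^ n <= 1)%R by (rewrite <- (pow1 n); apply pow_incr; lra).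
      specialize (Hpow n); nra. }
    assert (Hlow : (1 - Cmod x <= Cmod (1 - x))%R).
    { pose proof (Cmod_triangle (1 - x) x) as Ht.
      replace (1 - x + x) with (RtoC 1) in Ht by ring. rewrite Cmod_1 in Ht. lra. }
    assert (Hnz : 1 - x <> 0) by (apply Cmod_gt_0; lra).
    split; [apply Cmult_neq_0; auto|].
    replace (/ (qpoch p p n * (1 - x))) with (/ qpoch p p n * / (1 - x)) by (field; auto).
    rewrite Cmod_mult.
    replace (/ (1 - r) * (r * (1 - r ^ S n) / (1 - r)))%R with
      (/ (1 - r) * (r * (1 - r ^ n) / (1 - r)) + Cmod x * / (1 - r))%R
      by (rewrite Hx; simpl; field; lra).
    rewrite exp_plus. apply Rmult_le_compat; try apply Cmod_ge_0; auto.
    eapply Rle_trans; [|apply exp_ineq1_le].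
    rewrite Cmod_inv by exact Hnz.
    apply Rle_trans with (/ (1 - Cmod x))%R; [apply Rinv_le_contravar; lra|].
    pose proof (Cmod_ge_0 x).
    replace (/ (1 - Cmod x))%R with (1 + Cmod x * / (1 - Cmod x))%R by (field; lra).
    apply Rplus_le_compat_l, Rmult_le_compat_l; auto.
    apply Rinv_le_contravar; lra.
Qed.

Lemma qpoch_neq_0 (p : C) n : (Cmod p < 1)%R -> qpoch p p n <> 0.
Proof. intros Hp; apply (Cmod_qpoch_inv_le p n Hp). Qed.

Lemma qpoch_inf_neq_0 (p : C) : (Cmod p < 1)%R -> qpoch_inf p p <> 0.
Proof.
  intros Hp H0. pose proof (Clim_qpoch p p Hp) as Hl. rewrite H0 in Hl.
  set (K := exp (/ (1 - Cmod p) * / (1 - Cmod p))).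
  assert (HK : (0 < K)%R) by apply exp_pos.
  destruct (proj1 (Clim_eps _ _) Hl (mkposreal _ (Rinv_0_lt_compat _ HK))) as [N HN].
  specialize (HN N (le_n N)). simpl in HN.
  replace (qpoch p p N - 0) with (qpoch p p N) in HN by ring.
  destruct (Cmod_qpoch_inv_le p N Hp) as [Hn Hb]. fold K in Hb.
  rewrite Cmod_inv in Hb by exact Hn.
  apply Cmod_gt_0 in Hn.
  apply (Rmult_lt_compat_l K) in HN; auto. rewrite Rinv_r in HN by lra.
  apply (Rmult_le_compat_r (Cmod (qpoch p p N))) in Hb; [|lra].
  rewrite Rinv_l in Hb by lra. lra.
Qed.

Lemma Clim_qpoch_inv (p : C) : (Cmod p < 1)%R ->
  Clim (fun n => / qpoch p p n) (/ qpoch_inf p p).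
Proof.
  intros Hp. eapply Clim_inv.
  - intros n; apply qpoch_neq_0; auto.
  - intros n; apply (Cmod_qpoch_inv_le p n Hp).
  - apply Clim_qpoch; auto.
  - apply qpoch_inf_neq_0; auto.
Qed.

(** * Gaussian binomials *)

(* The Gaussian binomial in base [Cexp lq], extended by 0 to integers [k]
   outside [0..N]. *)
Fixpoint qbin (lq : C) (N : nat) (k : Z) : C :=
  match N with
  | O => if Z.eq_dec k 0 then 1 else 0
  | S N' => qbin lq N' k + qpower lq (INR N' + 1 - IZR k) * qbin lq N' (k - 1)
  end.

(** The second Pascal rule. The defining one adds a factor to (-z; q)_m, this one adds a factor to
    (-q/z; q)_n. *)
Lemma qbin_pascal (lq : C) N k :
  qbin lq (S N) k = qbin lq N (k - 1) + qpower lq (IZR k) * qbin lq N k.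
Proof.
  revert k. induction N as [|N IH]; intros k.
  - simpl. destruct (Z.eq_dec k 0) as [->|Hk]; [|destruct (Z.eq_dec (k - 1) 0) as [H1|H1]].
    + destruct (Z.eq_dec (0 - 1) 0); [lia|]. rewrite qpower_0. ring.
    + replace k with 1%Z by lia.
      replace (0 + 1 - IZR 1)%R with 0%R by (simpl; ring). rewrite qpower_0. ring.
    + ring.
  - change (qbin lq (S (S N)) k) with
      (qbin lq (S N) k + qpower lq (INR (S N) + 1 - IZR k) * qbin lq (S N) (k - 1)).
    transitivity (qbin lq N (k - 1) + qpower lq (IZR k) * qbin lq N k +
      qpower lq (INR (S N) + 1 - IZR k) *
      (qbin lq N (k - 1 - 1) + qpower lq (IZR (k - 1)) * qbin lq N (k - 1))).
    { rewrite <- !IH. reflexivity. }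
    simpl qbin. rewrite S_INR, !minus_IZR.
    replace (INR N + 1 + 1 - IZR k)%R with (INR N + 1 - (IZR k - 1))%R by ring.
    (* Applying the two rules in either order gives the same cross term: both exponents equal N +
       1. *)
    assert (E : qpower lq (INR N + 1 - (IZR k - 1)) * qpower lq (IZR k - 1) =
       qpower lq (IZR k) * qpower lq (INR N + 1 - IZR k)).
    { rewrite <- !qpower_plus. f_equal. ring. }
    ring [E].
Qed.

Lemma qbin_out (lq : C) N k : (k < 0 \/ Z.of_nat N < k)%Z -> qbin lq N k = 0.
Proof.
  revert k. induction N as [|N IH]; intros k H.
  - simpl. destruct (Z.eq_dec k 0); [lia|auto].
  - simpl qbin. rewrite !IH by lia. ring.
Qed.

(** The induction rests on 1 - q^(I+J) = (1 - q^J) + q^J (1 - q^I). At i = 0 or j = 0 one of the two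
    Pascal terms lies outside the range and vanishes. *)
Lemma qbin_qpoch (lq : C) (i j : nat) :
  qbin lq (i + j) (Z.of_nat i) * (qpoch (Cexp lq) (Cexp lq) i * qpoch (Cexp lq) (Cexp lq) j)
  = qpoch (Cexp lq) (Cexp lq) (i + j).
Proof.
  set (q := Cexp lq).
  assert (Hs : forall n, qpoch q q (S n) = qpoch q q n * (1 - qpower lq (INR n + 1))).
  { intros n. simpl. rewrite <- S_INR, qpower_pow. reflexivity. }
  remember (i + j)%nat as N eqn:HN. revert i j HN.
  induction N as [|N IH]; intros i j HN.
  - assert (i = 0%nat) as -> by lia. assert (j = 0%nat) as -> by lia.
    simpl. ring.
  - simpl qbin. destruct i as [|i].
    + assert (j = S N) as -> by lia.
      rewrite (qbin_out lq N (Z.of_nat 0 - 1)) by lia.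
      pose proof (IH 0%nat N eq_refl) as H. rewrite Hs.
      change (qpoch q q 0) with (RtoC 1) in *.
      transitivity (qbin lq N (Z.of_nat 0) * (1 * qpoch q q N) * (1 - qpower lq (INR N + 1)));
        [ring|rewrite H; ring].
    + replace (Z.of_nat (S i) - 1)%Z with (Z.of_nat i) by lia.
      pose proof (IH i j ltac:(lia)) as H1.
      replace (INR N + 1 - IZR (Z.of_nat (S i)))%R with (INR j).
      2:{ rewrite <- INR_IZR_INZ. replace N with (i + j)%nat by lia.
          rewrite plus_INR, S_INR. ring. }
      destruct j as [|j].
      * rewrite (qbin_out lq N (Z.of_nat (S i))) by lia.
        simpl (INR 0). rewrite qpower_0.
        replace N with i in * by lia. rewrite Hs.
        transitivity (qbin lq i (Z.of_nat i) * (qpoch q q i * qpoch q q 0)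
          * (1 - qpower lq (INR i + 1))); [ring|rewrite H1; ring].
      * pose proof (IH (S i) j ltac:(lia)) as H2.
        rewrite (Hs N).
        replace (INR N + 1)%R with (INR (S j) + (INR i + 1))%R
          by (replace N with (i + S j)%nat by lia; rewrite plus_INR; ring).
        rewrite qpower_plus.
        transitivity
          (qbin lq N (Z.of_nat (S i)) * (qpoch q q (S i) * qpoch q q j)
             * (1 - qpower lq (INR (S j))) +
           qpower lq (INR (S j)) * (1 - qpower lq (INR i + 1)) *
             (qbin lq N (Z.of_nat i) * (qpoch q q i * qpoch q q (S j)))).
        -- rewrite !Hs, S_INR. ring.
        -- rewrite H1, H2. ring.
Qed.

Lemma Cmod_Cexp_lt_1 lq : (Re lq < 0)%R -> (Cmod (Cexp lq) < 1)%R.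
Proof.
  intros Hq. rewrite Cmod_Cexp, <- exp_0. apply exp_increasing, Hq.
Qed.

Lemma qbin_eq (lq : C) (N : nat) (k : Z) : (Re lq < 0)%R ->
  (0 <= k <= Z.of_nat N)%Z ->
  qbin lq N k = qpoch (Cexp lq) (Cexp lq) N *
    (/ qpoch (Cexp lq) (Cexp lq) (Z.to_nat k) *
     / qpoch (Cexp lq) (Cexp lq) (N - Z.to_nat k)).
Proof.
  intros Hq Hk.
  pose proof (Cmod_Cexp_lt_1 lq Hq) as Hp.
  pose proof (qbin_qpoch lq (Z.to_nat k) (N - Z.to_nat k)) as H.
  replace (Z.to_nat k + (N - Z.to_nat k))%nat with N in H by lia.
  rewrite Z2Nat.id in H by lia. rewrite <- H.
  field. split; apply qpoch_neq_0, Hp.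
Qed.

(** Uniformity in both arguments comes from the bounds on (q;q)_n and its inverse, which are free of
    n. This constant is the [B] of the majorants below. *)
Lemma qbin_bounded (lq : C) : (Re lq < 0)%R ->
  exists K, (0 <= K)%R /\ forall N k, (Cmod (qbin lq N k) <= K)%R.
Proof.
  intros Hq. pose proof (Cmod_Cexp_lt_1 lq Hq) as Hp.
  set (K1 := exp (Cmod (Cexp lq) / (1 - Cmod (Cexp lq)))).
  set (K2 := exp (/ (1 - Cmod (Cexp lq)) * / (1 - Cmod (Cexp lq)))).
  assert (0 < K1)%R by apply exp_pos. assert (0 < K2)%R by apply exp_pos.
  assert (0 <= K1 * (K2 * K2))%R by (repeat apply Rmult_le_pos; lra).
  exists (K1 * (K2 * K2))%R. split; auto. intros N k.
  destruct (Z_lt_dec k 0); [|destruct (Z_lt_dec (Z.of_nat N) k)];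
    try (rewrite qbin_out, Cmod_0 by lia; auto).
  rewrite qbin_eq by (auto; lia). rewrite !Cmod_mult.
  repeat apply Rmult_le_compat; try (apply Rmult_le_pos); try apply Cmod_ge_0.
  - apply qpoch_le; auto.
  - apply Cmod_qpoch_inv_le; auto.
  - apply Cmod_qpoch_inv_le; auto.
Qed.

Lemma Clim_qbin (lq : C) (i : nat) : (Re lq < 0)%R ->
  Clim (fun N => qbin lq N (Z.of_nat i)) (/ qpoch (Cexp lq) (Cexp lq) i).
Proof.
  intros Hq. pose proof (Cmod_Cexp_lt_1 lq Hq) as Hp.
  apply Clim_ext_loc with (N := i) (s := fun N => qpoch (Cexp lq) (Cexp lq) N *
    (/ qpoch (Cexp lq) (Cexp lq) i * / qpoch (Cexp lq) (Cexp lq) (N - i))).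
  - intros n Hn. rewrite qbin_eq, Nat2Z.id by (auto; lia). reflexivity.
  - replace (/ qpoch (Cexp lq) (Cexp lq) i) with
      (qpoch_inf (Cexp lq) (Cexp lq) * (/ qpoch (Cexp lq) (Cexp lq) i *
         / qpoch_inf (Cexp lq) (Cexp lq))) at 1.
    + apply Clim_mult; [apply Clim_qpoch; auto|].
      apply Clim_mult; [apply Clim_const|].
      apply (Clim_subseq (fun n => / qpoch (Cexp lq) (Cexp lq) n) _
        (fun n => (n - i)%nat)).
      * intros K; exists (K + i)%nat; intros; lia.
      * apply Clim_qpoch_inv; auto.
    + field. split; [apply qpoch_neq_0; auto|apply qpoch_inf_neq_0; auto].
Qed.

Lemma Clim_qbin_central (lq : C) (k : Z) : (Re lq < 0)%R ->
  Clim (fun N => qbin lq (N + N) (Z.of_nat N + k)) (/ qpoch_inf (Cexp lq) (Cexp lq)).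
Proof.
  intros Hq. pose proof (Cmod_Cexp_lt_1 lq Hq) as Hp.
  (* From N >= |k| on, N + k lies between 0 and 2N, so the quotient formula applies; its two lower
     indices N + k and N - k both tend to infinity. *)
  apply Clim_ext_loc with (N := Z.abs_nat k)
    (s := fun N => qpoch (Cexp lq) (Cexp lq) (N + N) *
    (/ qpoch (Cexp lq) (Cexp lq) (Z.to_nat (Z.of_nat N + k)) *
     / qpoch (Cexp lq) (Cexp lq) (N + N - Z.to_nat (Z.of_nat N + k)))).
  - intros n Hn. rewrite qbin_eq by (auto; lia). reflexivity.
  - replace (/ qpoch_inf (Cexp lq) (Cexp lq)) with
      (qpoch_inf (Cexp lq) (Cexp lq) * (/ qpoch_inf (Cexp lq) (Cexp lq) *
         / qpoch_inf (Cexp lq) (Cexp lq))) by (field; apply qpoch_inf_neq_0; auto).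
    apply Clim_mult; [|apply Clim_mult].
    + apply (Clim_subseq (qpoch (Cexp lq) (Cexp lq)) _ (fun n => (n + n)%nat)).
      * intros K; exists K; intros; lia.
      * apply Clim_qpoch; auto.
    + apply (Clim_subseq (fun n => / qpoch (Cexp lq) (Cexp lq) n) _
        (fun n => Z.to_nat (Z.of_nat n + k))).
      * intros K; exists (K + Z.abs_nat k)%nat; intros; lia.
      * apply Clim_qpoch_inv; auto.
    + apply (Clim_subseq (fun n => / qpoch (Cexp lq) (Cexp lq) n) _
        (fun n => n + n - Z.to_nat (Z.of_nat n + k))%nat).
      * intros K; exists (K + Z.abs_nat k)%nat; intros; lia.
      * apply Clim_qpoch_inv; auto.
Qed.

(** * Finite and infinite triple products *)

Lemma Cpowz_of_nat (z : C) n : Cpowz z (Z.of_nat n) = z ^ n.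
Proof.
  destruct n as [|n]; [reflexivity|]. simpl Z.of_nat. unfold Cpowz.
  rewrite SuccNat2Pos.id_succ. reflexivity.
Qed.

Lemma Cpowz_opp_nat (z : C) n : Cpowz z (- Z.of_nat n) = / z ^ n.
Proof.
  destruct n as [|n]; [simpl; field|]. simpl Z.of_nat. unfold Cpowz, Z.opp.
  rewrite SuccNat2Pos.id_succ. reflexivity.
Qed.

Lemma Cpowz_succ (z : C) k : z <> 0 -> Cpowz z (k + 1) = Cpowz z k * z.
Proof.
  intros Hz. destruct (Z_le_dec 0 k) as [H|H].
  - rewrite <- (Z2Nat.id k H).
    replace (Z.of_nat (Z.to_nat k) + 1)%Z with (Z.of_nat (S (Z.to_nat k))) by lia.
    rewrite !Cpowz_of_nat. simpl. ring.
  - replace k with (- Z.of_nat (S (Z.to_nat (- k - 1))))%Z by lia.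
    replace (- Z.of_nat (S (Z.to_nat (- k - 1))) + 1)%Z
      with (- Z.of_nat (Z.to_nat (- k - 1)))%Z by lia.
    rewrite !Cpowz_opp_nat. simpl. field. split; [apply Cpow_nz|]; auto.
Qed.

Lemma Cpowz_pred (z : C) k : z <> 0 -> Cpowz z (k - 1) = Cpowz z k / z.
Proof.
  intros Hz. replace k with (k - 1 + 1)%Z at 2 by lia.
  rewrite Cpowz_succ by auto. field; auto.
Qed.

Lemma Cpowz_unique (z : C) (f : Z -> C) : z <> 0 -> f 0%Z = 1 ->
  (forall k, f (k + 1)%Z = f k * z) -> forall k, f k = Cpowz z k.
Proof.
  intros Hz H0 Hs k. induction k as [|k IH|k IH] using Z.peano_ind; auto.
  - unfold Z.succ. rewrite Hs, IH, Cpowz_succ; auto.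
  - unfold Z.pred. change (k + -1)%Z with (k - 1)%Z.
    rewrite Cpowz_pred, <- IH by auto.
    replace k with (k - 1 + 1)%Z at 2 by lia. rewrite Hs. field; auto.
Qed.

Lemma Cpowz_plus (z : C) m n : z <> 0 -> Cpowz z (m + n) = Cpowz z m * Cpowz z n.
Proof.
  intros Hz. induction n as [|n IH|n IH] using Z.peano_ind.
  - rewrite Z.add_0_r. simpl. ring.
  - replace (m + Z.succ n)%Z with (m + n + 1)%Z by lia. unfold Z.succ.
    rewrite !Cpowz_succ, IH by auto. ring.
  - replace (m + Z.pred n)%Z with (m + n - 1)%Z by lia.
    replace (Z.pred n) with (n - 1)%Z by lia.
    rewrite !Cpowz_pred, IH by auto. field; auto.
Qed.

Lemma Cpowz_mult_qpower (lq u : C) (a : R) k : u <> 0 ->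
  Cpowz (u * qpower lq a) k = Cpowz u k * qpower lq (a * IZR k).
Proof.
  intros Hu. symmetry. revert k. apply Cpowz_unique.
  - apply Cmult_neq_0; auto. apply qpower_neq_0.
  - rewrite Rmult_0_r, qpower_0. simpl. ring.
  - intros k. rewrite Cpowz_succ, plus_IZR by auto.
    replace (a * (IZR k + 1))%R with (a * IZR k + a)%R by ring.
    rewrite qpower_plus. ring.
Qed.

Definition qgauss (lq : C) (k : Z) : C := qpower lq (binom2 k).

Lemma qgauss_succ lq k : qgauss lq (k + 1) = qpower lq (IZR k) * qgauss lq k.
Proof.
  unfold qgauss. rewrite <- qpower_plus. f_equal.
  unfold binom2. rewrite plus_IZR. field.
Qed.

(* The coefficient of [z^k] in [(-z; q)_m (-q/z; q)_n]. *)
Definition jacobi_coef (lq : C) (m n : nat) (k : Z) : C :=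
  qbin lq (m + n) (Z.of_nat n + k) * qgauss lq k.

Lemma jacobi_coef_0 lq k :
  jacobi_coef lq 0 0 k = if Z.eq_dec k 0 then 1 else 0.
Proof.
  unfold jacobi_coef. simpl. destruct (Z.eq_dec k 0) as [->|]; [|ring].
  unfold qgauss, binom2. replace (_ / 2)%R with 0%R by field. rewrite qpower_0. ring.
Qed.

(** Coefficient form of multiplying by 1 + z q^m: the power of q in the recursion and the ratio
    q^(k-1) of consecutive Gaussian weights combine to q^m, free of k. *)
Lemma jacobi_coef_Sm lq m n k :
  jacobi_coef lq (S m) n k =
  jacobi_coef lq m n k + qpower lq (INR m) * jacobi_coef lq m n (k - 1).
Proof.
  unfold jacobi_coef. simpl qbin.
  replace (qgauss lq k) with (qpower lq (IZR (k - 1)) * qgauss lq (k - 1))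
    by (rewrite <- qgauss_succ; f_equal; lia).
  replace (Z.of_nat n + k - 1)%Z with (Z.of_nat n + (k - 1))%Z by lia.
  assert (E : qpower lq (INR (m + n) + 1 - IZR (Z.of_nat n + k)) * qpower lq (IZR (k - 1))
     = qpower lq (INR m)).
  { rewrite <- qpower_plus. f_equal.
    rewrite plus_INR, minus_IZR, plus_IZR, <- INR_IZR_INZ. ring. }
  rewrite <- E. ring.
Qed.

(** Coefficient form of multiplying by 1 + q^(n+1)/z. Raising n also moves the lower index of the
    binomial, which calls for [qbin_pascal] instead of the defining recursion. *)
Lemma jacobi_coef_Sn lq m n k :
  jacobi_coef lq m (S n) k =
  jacobi_coef lq m n k + qpower lq (INR n + 1) * jacobi_coef lq m n (k + 1).
Proof.
  unfold jacobi_coef. rewrite <- plus_n_Sm, qbin_pascal, qgauss_succ.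
  replace (Z.of_nat (S n) + k - 1)%Z with (Z.of_nat n + k)%Z by lia.
  replace (Z.of_nat (S n) + k)%Z with (Z.of_nat n + (k + 1))%Z by lia.
  replace (qpower lq (IZR (Z.of_nat n + (k + 1)))) with
    (qpower lq (INR n + 1) * qpower lq (IZR k)).
  - ring.
  - rewrite <- qpower_plus. f_equal.
    rewrite !plus_IZR, <- INR_IZR_INZ. ring.
Qed.

(** Transposes a shift from the test function to the coefficients, where the recurrences for
    [jacobi_coef] can absorb it. *)
Lemma is_sum_shift (t c : Z -> C) (d : Z) l :
  is_sum (fun k => t (k + d)%Z * c k) l -> is_sum (fun k => t k * c (k - d)%Z) l.
Proof.
  intros H. apply (is_sum_reindex (fun k => k - d)%Z) in H.
  - revert H. apply is_sum_ext; auto. intros k. do 2 f_equal. lia.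
  - intros; lia.
  - intros i _. exists (i + d)%Z. lia.
Qed.

Lemma is_sum_shift2 (t : Z * Z -> C) (c d : Z -> C) (x y : Z) l :
  is_sum (fun ij => t (fst ij + x, snd ij + y)%Z * (c (fst ij) * d (snd ij))) l ->
  is_sum (fun ij => t ij * (c (fst ij - x)%Z * d (snd ij - y)%Z)) l.
Proof.
  intros H. apply (is_sum_reindex (fun ij => (fst ij - x, snd ij - y)%Z)) in H.
  - revert H. apply is_sum_ext; auto. intros [i j]. simpl.
    replace (i - x + x)%Z with i by lia. replace (j - y + y)%Z with j by lia. auto.
  - intros [i j] [i' j'] E. injection E. intros. f_equal; lia.
  - intros [i j] _. exists (i + x, j + y)%Z. simpl. f_equal; lia.
Qed.

Theorem finite_jacobi_triple_product (lq z : C) m n : z <> 0 ->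
  is_sum (fun k => Cpowz z k * jacobi_coef lq m n k)
    (qpoch (- z) (Cexp lq) m * qpoch (- Cexp lq / z) (Cexp lq) n).
Proof.
  intros Hz. induction m as [|m IH]; [induction n as [|n IH]|].
  - apply is_sum_ext with (f := fun k => Cpowz z k * jacobi_coef lq 0 0 k)
      (l := Cpowz z 0 * jacobi_coef lq 0 0 0); auto.
    + rewrite jacobi_coef_0. simpl. ring.
    + apply (is_sum_single (fun k => Cpowz z k * jacobi_coef lq 0 0 k)).
      intros k Hk. rewrite jacobi_coef_0. destruct (Z.eq_dec k 0); [lia|ring].
  (* The new factor 1 + q^(n+1)/z adds a copy of the sum with z^(k-1) in place of z^k; moving this
     shift onto the coefficients gives [jacobi_coef_Sn]. *)
  - pose proof (is_sum_scal (qpower lq (INR n + 1) / z) _ _ IH) as H.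
    pose proof (is_sum_shift (fun k => qpower lq (INR n + 1) * Cpowz z k)
      (jacobi_coef lq 0 n) (-1)) as Hs.
    eapply is_sum_ext; [| |refine (is_sum_plus _ _ _ _ IH _); apply Hs;
      eapply is_sum_ext; [| |apply H]; [|reflexivity]].
    + intros k. rewrite jacobi_coef_Sn. simpl.
      replace (k - -1)%Z with (k + 1)%Z by lia. ring.
    + simpl. rewrite <- S_INR, qpower_pow. simpl. field; auto.
    + intros k. simpl. replace (k + -1)%Z with (k - 1)%Z by lia.
      rewrite Cpowz_pred by auto. field; auto.
  - pose proof (is_sum_scal (qpower lq (INR m) * z) _ _ IH) as H.
    pose proof (is_sum_shift (fun k => qpower lq (INR m) * Cpowz z k)
      (jacobi_coef lq m n) 1) as Hs.
    eapply is_sum_ext; [| |refine (is_sum_plus _ _ _ _ IH _); apply Hs;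
      eapply is_sum_ext; [| |apply H]; [|reflexivity]].
    + intros k. rewrite jacobi_coef_Sm. simpl. ring.
    + simpl. rewrite qpower_pow. ring.
    + intros k. simpl. rewrite Cpowz_succ by auto. ring.
Qed.

(** The case n = 0 of [jacobi_coef_Sm]: these products are the coefficients of (-z; q)_m alone. *)
Lemma qbin_gauss_S lq m i :
  qbin lq (S m) i * qgauss lq i = qbin lq m i * qgauss lq i +
    qpower lq (INR m) * (qbin lq m (i - 1) * qgauss lq (i - 1)).
Proof.
  pose proof (jacobi_coef_Sm lq m 0 i) as H. unfold jacobi_coef in H.
  rewrite !Nat.add_0_r in H. exact H.
Qed.

(* q-Vandermonde summation, tested against an arbitrary [t]: both sums are
   obtained from [t 0] by the same shift operators. *)
Theorem qvandermonde (lq : C) m n (t : Z -> C) : exists l,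
  is_sum (fun k => t k * jacobi_coef lq m n k) l /\
  is_sum (fun ij => t (fst ij - snd ij)%Z *
    ((qbin lq m (fst ij) * qgauss lq (fst ij)) *
     (qbin lq n (snd ij) * qgauss lq (snd ij + 1)))) l.
Proof.
  revert t. induction m as [|m IH]; [induction n as [|n IH]|]; intros t.
  - exists (t 0%Z). split.
    + apply is_sum_ext with (f := fun k => t k * jacobi_coef lq 0 0 k)
        (l := t 0%Z * jacobi_coef lq 0 0 0); auto.
      * rewrite jacobi_coef_0. simpl. ring.
      * apply (is_sum_single (fun k => t k * jacobi_coef lq 0 0 k)).
        intros k Hk. rewrite jacobi_coef_0. destruct (Z.eq_dec k 0); [lia|ring].
    + eapply is_sum_ext; [intros; reflexivity| |apply is_sum_single with (i0 := (0, 0)%Z)].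
      * simpl. unfold qgauss, binom2. simpl.
        replace (0 * (0 - 1) / 2)%R with 0%R by field.
        replace (1 * (1 - 1) / 2)%R with 0%R by field.
        rewrite qpower_0. ring.
      * intros [i j] Hij. simpl.
        destruct (Z.eq_dec i 0); [|ring]. destruct (Z.eq_dec j 0); [|ring].
        subst; easy.
  - destruct (IH t) as [l0 [H0 H0']].
    (* The new factor acts on [t] as the identity plus a multiple of a shift, so the induction
       hypothesis is needed at [t] and at its shift. In the double sum the shift of i - j by -1 is
       absorbed by raising j. *)
    destruct (IH (fun k => t (k - 1)%Z)) as [l1 [H1 H1']].
    exists (l0 + qpower lq (INR n + 1) * l1). split.
    + eapply is_sum_ext; [|reflexivity|refine (is_sum_plus _ _ _ _ H0 _);
        apply is_sum_scal; apply (is_sum_shift t (jacobi_coef lq 0 n) (-1)); apply H1].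
      intros k. rewrite jacobi_coef_Sn. simpl.
      replace (k - -1)%Z with (k + 1)%Z by lia. ring.
    + eapply is_sum_ext; [|reflexivity|refine (is_sum_plus _ _ _ _ H0' _);
        apply is_sum_scal; apply (is_sum_shift2 (fun ij => t (fst ij - snd ij)%Z)
         (fun i => qbin lq 0 i * qgauss lq i)
         (fun j => qbin lq n j * qgauss lq (j + 1)) 0 1);
        eapply is_sum_ext; [|reflexivity|apply H1']].
      * intros [i j]. cbn [fst snd]. rewrite Z.sub_0_r.
        (* The recurrence for the coefficients of (-q/z; q)_n in powers of 1/z, whose weight is
           q^(C(j+1,2)). *)
        replace (qbin lq (S n) j * qgauss lq (j + 1)) with
          (qbin lq n j * qgauss lq (j + 1) +
           qpower lq (INR n + 1) * (qbin lq n (j - 1) * qgauss lq (j - 1 + 1))).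
        -- ring.
        -- replace (j - 1 + 1)%Z with j by lia. rewrite qgauss_succ.
           simpl (qbin lq (S n) j).
           replace (qpower lq (INR n + 1)) with
             (qpower lq (INR n + 1 - IZR j) * qpower lq (IZR j))
             by (rewrite <- qpower_plus; f_equal; ring).
           ring.
      * intros [i j]. cbn [fst snd].
        replace (i + 0 - (j + 1))%Z with (i - j - 1)%Z by lia. reflexivity.
  - destruct (IH t) as [l0 [H0 H0']].
    destruct (IH (fun k => t (k + 1)%Z)) as [l1 [H1 H1']].
    exists (l0 + qpower lq (INR m) * l1). split.
    + eapply is_sum_ext; [|reflexivity|refine (is_sum_plus _ _ _ _ H0 _);
        apply is_sum_scal; apply (is_sum_shift t (jacobi_coef lq m n) 1); apply H1].
      intros k. rewrite jacobi_coef_Sm. ring.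
    + eapply is_sum_ext; [|reflexivity|refine (is_sum_plus _ _ _ _ H0' _);
        apply is_sum_scal; apply (is_sum_shift2 (fun ij => t (fst ij - snd ij)%Z)
         (fun i => qbin lq m i * qgauss lq i)
         (fun j => qbin lq n j * qgauss lq (j + 1)) 1 0);
        eapply is_sum_ext; [|reflexivity|apply H1']].
      * intros [i j]. cbn [fst snd]. rewrite Z.sub_0_r, qbin_gauss_S. ring.
      * intros [i j]. cbn [fst snd].
        replace (i + 1 - (j + 0))%Z with (i - j + 1)%Z by lia. reflexivity.
Qed.

(** * Gaussian decay and passage to the limit *)

Lemma pow_gauss_bounded (y s : R) : (0 <= y)%R -> (s < 0)%R ->
  exists K, (0 <= K)%R /\
    forall n, (y ^ n * exp (binom2 (Z.of_nat n) * s) <= K * (/ 2) ^ n)%R.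
Proof.
  intros Hy Hs.
  (* The extra 2^n in [b] becomes (1/2)^n in the bound, so boundedness of [b] suffices; its ratio 2
     y exp(n s) tends to 0. *)
  set (b := fun n => ((2 * y) ^ n * exp (binom2 (Z.of_nat n) * s))%R).
  assert (Hb0 : forall n, (0 <= b n)%R).
  { intros n; apply Rmult_le_pos; [apply pow_le; lra|left; apply exp_pos]. }
  assert (HbS : forall n, b (S n) = (b n * (2 * y * exp (INR n * s)))%R).
  { intros n. unfold b.
    replace (binom2 (Z.of_nat (S n)) * s)%R
      with (binom2 (Z.of_nat n) * s + INR n * s)%R.
    - rewrite exp_plus. simpl. ring.
    - unfold binom2. rewrite <- !INR_IZR_INZ, S_INR. field. }
  (* From [n0] on, exp(-n s) >= 1 - n s >= 2 y, so the ratio is at most 1. *)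
  destruct (INR_unbounded (2 * y / - s)) as [n0 Hn0].
  assert (Hdec : forall n, (n0 <= n)%nat -> (b (S n) <= b n)%R).
  { intros n Hn. rewrite HbS. rewrite <- (Rmult_1_r (b n)) at 2.
    apply Rmult_le_compat_l; auto.
    apply le_INR in Hn.
    assert (H2 : (2 * y <= exp (- (INR n * s)))%R).
    { eapply Rle_trans; [|apply exp_ineq1_le].
      apply (Rmult_gt_compat_r (- s)) in Hn0; [|lra].
      unfold Rdiv in Hn0. rewrite Rmult_assoc, Rinv_l in Hn0 by lra. nra. }
    rewrite exp_Ropp in H2. pose proof (exp_pos (INR n * s)).
    apply (Rmult_le_compat_r (exp (INR n * s))) in H2; [|lra].
    rewrite Rinv_l in H2 by lra. lra. }
  assert (Hfin : forall N, exists K, forall n, (n <= N)%nat -> (b n <= K)%R).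
  { induction N as [|N [K HK]].
    - exists (b 0%nat). intros n Hn. replace n with 0%nat by lia. lra.
    - exists (Rmax K (b (S N))). intros n Hn.
      destruct (le_lt_dec n N) as [H|H].
      + eapply Rle_trans; [apply HK; auto|apply Rmax_l].
      + replace n with (S N) by lia. apply Rmax_r. }
  destruct (Hfin n0) as [K HK].
  assert (HbK : forall n, (b n <= K)%R).
  { intros n. destruct (le_lt_dec n n0) as [H|H]; auto.
    replace n with (n0 + (n - n0))%nat by lia.
    induction (n - n0)%nat as [|k IH].
    - rewrite Nat.add_0_r. auto.
    - rewrite <- plus_n_Sm. eapply Rle_trans; [apply Hdec; lia|auto]. }
  exists K. split; [eapply Rle_trans; [apply (Hb0 0%nat)|auto]|].
  intros n. replace (y ^ n)%R with ((2 * y) ^ n * (/ 2) ^ n)%R.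
  - specialize (HbK n). unfold b in HbK.
    assert (0 <= (/ 2) ^ n)%R by (apply pow_le; lra). nra.
  - rewrite <- Rpow_mult_distr. f_equal. field.
Qed.

Lemma Cpowz_gauss_le (lq z : C) : (Re lq < 0)%R -> z <> 0 ->
  exists K, (0 <= K)%R /\
    forall k, (Cmod (Cpowz z k * qgauss lq k) <= K * (/ 2) ^ Z.abs_nat k)%R.
Proof.
  intros Hq Hz.
  destruct (pow_gauss_bounded (Cmod z) (Re lq) (Cmod_ge_0 z) Hq) as [K1 [HK1 H1]].
  destruct (pow_gauss_bounded (Cmod (/ z)) (Re lq) (Cmod_ge_0 _) Hq) as [K2 [HK2 H2]].
  exists (K1 + K2)%R. split; [lra|]. intros k.
  assert (Hp : (0 <= (/ 2) ^ Z.abs_nat k)%R) by (apply pow_le; lra).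
  rewrite Cmod_mult. unfold qgauss. rewrite Cmod_qpower.
  destruct (Z_le_dec 0 k) as [Hk|Hk].
  - specialize (H1 (Z.abs_nat k)). rewrite <- Cmod_pow, <- Cpowz_of_nat in H1.
    replace (Z.of_nat (Z.abs_nat k)) with k in H1 by lia. nra.
  - specialize (H2 (Z.abs_nat k)).
    replace (Cpowz z k) with ((/ z) ^ Z.abs_nat k).
    + rewrite Cmod_pow.
      apply Rle_trans with (Cmod (/ z) ^ Z.abs_nat k *
        exp (binom2 (Z.of_nat (Z.abs_nat k)) * Re lq))%R; [|nra].
      apply Rmult_le_compat_l; [apply pow_le, Cmod_ge_0|].
      (* For k < 0, C(k,2) = C(-k,2) - k exceeds C(-k,2), and the negative [Re lq] makes the
         exponential smaller. *)
      apply exp_le_compat. replace (Z.of_nat (Z.abs_nat k)) with (- k)%Z by lia.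
      unfold binom2. rewrite opp_IZR. apply Znot_le_gt, Z.gt_lt, IZR_lt in Hk. nra.
    + replace k with (- Z.of_nat (Z.abs_nat k))%Z at 2 by lia.
      rewrite Cpowz_opp_nat, Cpow_inv by auto. reflexivity.
Qed.

Theorem jacobi_triple_product (lq z : C) : (Re lq < 0)%R -> z <> 0 ->
  is_sum (fun k => Cpowz z k * qgauss lq k)
    (qpoch_inf (- z) (Cexp lq) * qpoch_inf (- Cexp lq / z) (Cexp lq)
     * qpoch_inf (Cexp lq) (Cexp lq)).
Proof.
  intros Hq Hz. pose proof (Cmod_Cexp_lt_1 lq Hq) as Hp.
  destruct (Cpowz_gauss_le lq z Hq Hz) as [K [HK HKb]].
  destruct (qbin_bounded lq Hq) as [B [HB HBb]].
  (* The central binomials tend to 1/(q;q)_oo, so the limit carries this factor; it is cleared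
     afterwards and produces the third product. *)
  assert (H : is_sum (fun k => Cpowz z k * qgauss lq k * / qpoch_inf (Cexp lq) (Cexp lq))
    (qpoch_inf (- z) (Cexp lq) * qpoch_inf (- Cexp lq / z) (Cexp lq))).
  { apply tannery with (M := fun k => (K * B * (/ 2) ^ Z.abs_nat k)%R)
      (F := fun N k => Cpowz z k * jacobi_coef lq N N k)
      (L := fun N => qpoch (- z) (Cexp lq) N * qpoch (- Cexp lq / z) (Cexp lq) N).
    - apply summable_geomZ, Rmult_le_pos; auto.
    - intros n k. unfold jacobi_coef.
      replace (_ * _) with
        (Cpowz z k * qgauss lq k * qbin lq (n + n) (Z.of_nat n + k)) by ring.
      rewrite Cmod_mult.
      replace (K * B * (/ 2) ^ Z.abs_nat k)%R
        with (K * (/ 2) ^ Z.abs_nat k * B)%R by ring.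
      apply Rmult_le_compat; auto using Cmod_ge_0.
    - intros k. apply Clim_ext with (s := fun N => Cpowz z k * qgauss lq k *
        qbin lq (N + N) (Z.of_nat N + k)).
      + intros n. unfold jacobi_coef. ring.
      + apply Clim_mult; [apply Clim_const|apply Clim_qbin_central; auto].
    - intros n. apply finite_jacobi_triple_product; auto.
    - apply Clim_mult; apply Clim_qpoch; auto. }
  apply (is_sum_scal (qpoch_inf (Cexp lq) (Cexp lq))) in H.
  eapply is_sum_ext; [| |exact H].
  - intros k; cbv beta. field. apply qpoch_inf_neq_0; auto.
  - ring.
Qed.

(** For each N the finite identity attaches one number [L N] to both sums. [tannery_lim] finds the
    limit of [L] from the bilateral side, whose sum is given, and [tannery] transfers it to the
    double sum. *)
Theorem double_sum_eq_bilateral (lq u : C) (a : R) (l : C) :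
  (Re lq < 0)%R -> (0 <= a)%R -> u <> 0 ->
  is_sum (fun k => Cpowz u k * qpower lq (a * binom2 (- k)) * qgauss lq k) l ->
  is_sum (fun ij : nat * nat =>
    let i := Z.of_nat (fst ij) in let j := Z.of_nat (snd ij) in
    Cpowz u (i - j) * qpower lq (a * binom2 (- (i - j))) *
    ((/ qpoch (Cexp lq) (Cexp lq) (fst ij) * qgauss lq i) *
     (/ qpoch (Cexp lq) (Cexp lq) (snd ij) * qgauss lq (j + 1))))
    (l * / qpoch_inf (Cexp lq) (Cexp lq)).
Proof.
  intros Hq Ha Hu Hl. pose proof (Cmod_Cexp_lt_1 lq Hq) as Hp.
  set (t := fun k => Cpowz u k * qpower lq (a * binom2 (- k))) in *.
  destruct (Cpowz_gauss_le lq u Hq Hu) as [K [HK HKb]].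
  destruct (qbin_bounded lq Hq) as [B [HB HBb]].
  (* Integrality matters here: k(k-1)/2 is negative only for real k strictly between 0 and 1. *)
  assert (Hbin : forall k, (0 <= binom2 k)%R).
  { intros k. unfold binom2. destruct (Z_le_dec 1 k) as [H|H].
    - apply IZR_le in H. nra.
    - assert (H' : (k <= 0)%Z) by lia. apply IZR_le in H'. nra. }
  assert (Htq : forall k, (Cmod (qpower lq (a * binom2 (- k))) <= 1)%R).
  { intros k. apply Cmod_qpower_le_1; [lra|]. apply Rmult_le_pos; auto. }
  (* [qvandermonde] only asserts that a common value exists; a choice turns these values into a
     sequence, of which nothing else is used. *)
  set (L := fun N => proj1_sig (constructive_indefinite_description _
    (qvandermonde lq N N t))).
  assert (HL : forall N, is_sum (fun k => t k * jacobi_coef lq N N k) (L N) /\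
    is_sum (fun ij => t (fst ij - snd ij)%Z *
    ((qbin lq N (fst ij) * qgauss lq (fst ij)) *
     (qbin lq N (snd ij) * qgauss lq (snd ij + 1)))) (L N)).
  { intros N. unfold L. destruct constructive_indefinite_description; auto. }
  clearbody L.
  assert (Hlim : Clim L (l * / qpoch_inf (Cexp lq) (Cexp lq))).
  { apply tannery_lim with (M := fun k => (K * B * (/ 2) ^ Z.abs_nat k)%R)
      (F := fun N k => t k * jacobi_coef lq N N k)
      (f := fun k => t k * qgauss lq k * / qpoch_inf (Cexp lq) (Cexp lq)).
    - apply summable_geomZ, Rmult_le_pos; auto.
    - intros n k. unfold jacobi_coef, t.
      replace (_ * _) with (qpower lq (a * binom2 (- k)) *
        (Cpowz u k * qgauss lq k * qbin lq (n + n) (Z.of_nat n + k))) by ring.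
      rewrite !(Cmod_mult _ (_ * _)), (Cmod_mult (_ * _) (qbin _ _ _)).
      replace (K * B * (/ 2) ^ Z.abs_nat k)%R
        with (1 * (K * (/ 2) ^ Z.abs_nat k * B))%R by ring.
      apply Rmult_le_compat; auto using Cmod_ge_0.
      + apply Rmult_le_pos; apply Cmod_ge_0.
      + apply Rmult_le_compat; auto using Cmod_ge_0.
    - intros k. apply Clim_ext with (s := fun N => t k * qgauss lq k *
        qbin lq (N + N) (Z.of_nat N + k)).
      + intros n. unfold jacobi_coef. ring.
      + apply Clim_mult; [apply Clim_const|apply Clim_qbin_central; auto].
    - intros n; apply HL.
    - eapply is_sum_ext; [| |apply (is_sum_scal (/ qpoch_inf (Cexp lq) (Cexp lq))), Hl].
      + intros k. unfold t. ring.
      + ring. }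
  apply tannery with
    (M := fun ij => (K * B * (K * B) * (/ 2) ^ (fst ij) * (/ 2) ^ (snd ij))%R)
    (F := fun N ij => let i := Z.of_nat (fst ij) in let j := Z.of_nat (snd ij) in
       t (i - j)%Z * ((qbin lq N i * qgauss lq i) * (qbin lq N j * qgauss lq (j + 1))))
    (L := L); auto.
  - apply summable_geom2. repeat apply Rmult_le_pos; auto.
  - intros n [i j]. cbn [fst snd]. unfold t.
    (* By C(j+1,2) = C(-j,2) the j-part becomes u^(-j) q^(C(-j,2)), and the bilateral estimate
       applies at i and at -j. *)
    replace (qgauss lq (Z.of_nat j + 1)) with (qgauss lq (- Z.of_nat j)).
    2:{ unfold qgauss. f_equal. unfold binom2. rewrite plus_IZR, opp_IZR. field. }
    unfold Z.sub at 1. rewrite Cpowz_plus by auto.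
    set (i' := Z.of_nat i). set (j' := (- Z.of_nat j)%Z).
    replace (_ * _) with (qpower lq (a * binom2 (- (i' - Z.of_nat j))) *
      ((Cpowz u i' * qgauss lq i') * qbin lq n i' *
       ((Cpowz u j' * qgauss lq j') * qbin lq n (Z.of_nat j)))) by ring.
    rewrite Cmod_mult.
    rewrite (Cmod_mult (Cpowz u i' * qgauss lq i' * qbin lq n i')).
    rewrite (Cmod_mult (Cpowz u i' * qgauss lq i')).
    rewrite (Cmod_mult (Cpowz u j' * qgauss lq j')).
    pose proof (HKb i') as Hi. pose proof (HKb j') as Hj.
    replace (Z.abs_nat i') with i in Hi by lia.
    replace (Z.abs_nat j') with j in Hj by lia.
    replace (K * B * (K * B) * (/ 2) ^ i * (/ 2) ^ j)%R with
      (1 * ((K * (/ 2) ^ i * B) * (K * (/ 2) ^ j * B)))%R by ring.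
    repeat apply Rmult_le_compat; auto; repeat apply Rmult_le_pos; apply Cmod_ge_0.
  - intros [i j]. cbn [fst snd].
    apply Clim_mult; [apply Clim_const|].
    apply Clim_mult; apply Clim_mult; try apply Clim_const; apply Clim_qbin; auto.
  - intros N. destruct (HL N) as [_ H].
    (* Restricting from integer pairs to natural ones loses nothing, as the binomials vanish at
       negative indices. *)
    apply (is_sum_reindex (fun ij : nat * nat => (Z.of_nat (fst ij), Z.of_nat (snd ij)))) in H.
    + exact H.
    + intros [i j] [i' j'] E. injection E. intros. f_equal; lia.
    + intros [i j] H0. exists (Z.to_nat i, Z.to_nat j). simpl.
      destruct (Z_lt_dec i 0) as [Hi|Hi];
        [exfalso; apply H0; simpl; rewrite qbin_out by lia; ring|].
      destruct (Z_lt_dec j 0) as [Hj|Hj];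
        [exfalso; apply H0; simpl; rewrite (qbin_out _ _ j) by lia; ring|].
      f_equal; lia.
Qed.

Theorem theorem3p5 (q logq : C) (a : R) (u : C)
  (hlog : Cexp logq = q)
  (hq : (0 < Cmod q < 1)%R)
  (ha : (0 < a)%R)
  (hu : u <> 0) :
  is_sum
    (fun ij : nat * nat =>
       let (i, j) := ij in
       Cpowz u (Z.of_nat i - Z.of_nat j)
       * qpower logq (binom2 (Z.of_nat i) + binom2 (Z.of_nat j + 1)
                      + a * binom2 (Z.of_nat j - Z.of_nat i))%R
       / (qpoch q q i * qpoch q q j))
    (qpochs_inf [- u * qpower logq a; - q / u; qpower logq (a + 1)%R]
       (qpower logq (a + 1)%R)
     / qpoch_inf q q).
Proof.
  subst q. rewrite Cmod_Cexp in hq.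
  assert (Hq : (Re logq < 0)%R).
  { apply exp_lt_inv. rewrite exp_0. apply hq. }
  pose proof (Cmod_Cexp_lt_1 _ Hq) as Hp.
  set (z := u * qpower logq a).
  assert (Hz : z <> 0) by (apply Cmult_neq_0; auto; apply qpower_neq_0).
  (* Base Q = q^(a+1) enters through its logarithm, whose real part is again negative. *)
  assert (HQ : (Re (RtoC (a + 1) * logq) < 0)%R).
  { unfold Re in *; simpl. nra. }
  pose proof (jacobi_triple_product _ z HQ Hz) as HJ.
  eapply is_sum_ext; [| |eapply (double_sum_eq_bilateral logq u a);
    [exact Hq|lra|exact hu|eapply is_sum_ext; [|reflexivity|exact HJ]]].
  - intros [i j]. cbn [fst snd]. unfold qgauss.
    replace (- (Z.of_nat i - Z.of_nat j))%Z with (Z.of_nat j - Z.of_nat i)%Z by lia.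
    rewrite !qpower_plus. field. split; apply qpoch_neq_0; auto.
  - change (qpower logq (a + 1)) with (Cexp (RtoC (a + 1) * logq)).
    unfold qpochs_inf. simpl map. unfold fold_right.
    replace (- z) with (- u * qpower logq a) by (unfold z; ring).
    (* Q/z = q/u, because Q = q^a q and z = u q^a. *)
    replace (- Cexp (RtoC (a + 1) * logq) / z) with (- Cexp logq / u).
    + field. apply qpoch_inf_neq_0; auto.
    + unfold z. change (Cexp (RtoC (a + 1) * logq)) with (qpower logq (a + 1)).
      rewrite qpower_plus. replace (qpower logq 1) with (Cexp logq).
      * field. split; auto. apply qpower_neq_0.
      * unfold qpower. f_equal. ring.
  (* From C(-k,2) = C(k,2) + k follows a C(-k,2) + C(k,2) = a k + (a+1) C(k,2): the linear part goes
     into z^k, the rest is the Gaussian weight in base Q. *)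
  - intros k. unfold z, qgauss.
    rewrite Cpowz_mult_qpower, qpower_scal by auto.
    rewrite <- !Cmult_assoc, <- !qpower_plus. do 2 f_equal.
    unfold binom2. rewrite opp_IZR. field.
Qed.
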